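(* Let $L=\mathbb{Q}(\xi)$ be an algebraic number field of degree $n$ with $\xi$ an algebraic integer, and let $A_L$ be the ring of algebraic integers of $L$. Assume that $A_L\neq\mathbb{Z}[\xi]$. Let $p_1,\dots,p_s$ be all the distinct primes dividing the index $[A_L:\mathbb{Z}[\xi]]$. For $1\le r\le s$ let $\mathcal{B}_r=\{\alpha_{r0},\alpha_{r1},\dots,\alpha_{r(n-1)}\}$ be a $p_r$-integral basis of $L$ with $\alpha_{r0}=1$ and $$\alpha_{ri}=\frac{c_{i0}^{(r)}+c_{i1}^{(r)}\xi+\cdots+c_{i\,i-1}^{(r)}\xi^{i-1}+\xi^i}{p_r^{k_{i,r}}},\qquad 1\le i\le n-1,$$ where the $c_{ij}^{(r)}$ and the $k_{i,r}$ are integers with $0\le k_{i,r}\le k_{i+1,r}$. If $c_{ij}\in\mathbb{Z}$ are such that $c_{ij}\equiv c_{ij}^{(r)}\pmod{p_r^{k_{i,r}}}$ for $1\le r\le s$ (for all $1\le i\le n-1$, $0\le j\le i-1$), and if $t_i=\prod_{r=1}^{s}p_r^{k_{i,r}}$, then $\{\alpha_0,\alpha_1,\dots,\alpha_{n-1}\}$ is an integral basis of $L$, where $\alpha_0=1$ and $$\alpha_i=\frac{c_{i0}+c_{i1}\xi+\cdots+c_{i\,i-1}\xi^{i-1}+\xi^i}{t_i}\qquad\text{for }1\le i\le n-1.$$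
   Context: For a prime $p$, $\mathbb{Z}_{(p)}$ is the localisation of $\mathbb{Z}$ at $p\mathbb{Z}$, and $S_{(p)}$ is the integral closure of $\mathbb{Z}_{(p)}$ in $L$. A $p$-integral basis of $L$ is a $\mathbb{Z}_{(p)}$-basis of the free $\mathbb{Z}_{(p)}$-module $S_{(p)}$. An integral basis of $L$ is a $\mathbb{Z}$-basis of $A_L$. *)

(* Defs.v *)
From HB Require Import structures.
From mathcomp Require Import all_boot all_order all_algebra all_field.
From mathcomp Require Import boolp classical_sets.

Set Implicit Arguments.
Unset Strict Implicit.
Unset Printing Implicit Defensive.

Import Order.TTheory GRing.Theory Num.Theory.
Local Open Scope ring_scope.

(* The rationals whose reduced denominator is prime to p.  Writing "coprime"
   rather than "not divisible" makes this a subring of Q for every p; the two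
   agree when p is prime (in_zlocal). *)
Definition zlocal (p : nat) : {pred rat} :=
  fun q => coprime p `|denq q|%N.

Lemma in_zlocal (p : nat) (q : rat) :
  prime p -> (q \in zlocal p) = ~~ (p %| `|denq q|)%N.
Proof. by move=> p_pr; rewrite unfold_in prime_coprime. Qed.

Lemma zlocal_frac (p : nat) (a b : int) :
  coprime p `|b|%N -> a%:~R / b%:~R \in zlocal p.
Proof.
move=> pb; rewrite unfold_in; apply: coprime_dvdr pb.
have [->|b0] := eqVneq b 0; first by rewrite absz0 dvdn0.
set q : rat := _ / _.
have E : numq q * b = a * denq q.
  apply: (@intr_inj rat); rewrite !intrM.
  have b0' : b%:~R != 0 :> rat by rewrite intr_eq0.
  have d0 : (denq q)%:~R != 0 :> rat by rewrite intr_eq0 denq_neq0.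
  have : (numq q)%:~R / (denq q)%:~R = a%:~R / b%:~R :> rat by rewrite divq_num_den.
  by move/eqP; rewrite eqr_div // => /eqP.
have : (`|denq q| %| `|numq q| * `|b|)%N by rewrite -abszM E abszM dvdn_mull.
by rewrite Gauss_dvdr // coprime_sym coprime_num_den.
Qed.

Lemma zlocal_subring_closed (p : nat) : subring_closed (zlocal p).
Proof.
have cd (x y : rat) : x \in zlocal p -> y \in zlocal p ->
    coprime p `|(denq x * denq y)%R|%N.
  by rewrite !unfold_in abszM coprimeMr => -> ->.
split=> [|x y px py|x y px py].
- by rewrite unfold_in (denq_int 1) coprimen1.
- have -> : x - y = (numq x * denq y - numq y * denq x)%:~R
                    / (denq x * denq y)%:~R.
    rewrite -{1}[x]divq_num_den -{1}[y]divq_num_den.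
    rewrite -[- (_ / _)]mulNr addf_div ?intr_eq0 ?denq_neq0 //.
    by rewrite mulNr rmorphB !rmorphM.
  exact: zlocal_frac (cd _ _ px py).
- have -> : x * y = (numq x * numq y)%:~R / (denq x * denq y)%:~R.
    rewrite -{1}[x]divq_num_den -{1}[y]divq_num_den.
    by rewrite !rmorphM /= mulf_div.
  exact: zlocal_frac (cd _ _ px py).
Qed.

HB.instance Definition _ (p : nat) :=
  GRing.isSubringClosed.Build rat (zlocal p) (zlocal_subring_closed p).

Record Zlocal (p : nat) :=
  ZLocal { zlocal_val :> rat; zlocal_valP : zlocal_val \in zlocal p }.

HB.instance Definition _ (p : nat) := [isSub for @zlocal_val p].
HB.instance Definition _ (p : nat) := [Choice of Zlocal p by <:].
HB.instance Definition _ (p : nat) :=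
  [SubChoice_isSubComNzRing of Zlocal p by <:].

Section NumberField.
Variable L : fieldExtType rat.

Definition int_embed : {rmorphism int -> L} := intr.
Definition zlocal_embed (p : nat) : {rmorphism Zlocal p -> L} :=
  in_alg L \o val.

Definition integral_closure (R : nzRingType) (f : {rmorphism R -> L}) : set L :=
  [set x | integralOver f x]%classic.

(* f supplies the R-module structure of L.  The equivalence also gives that the
   b i lie in M and that M is an R-submodule. *)
Definition is_module_basis (R : nzRingType) (f : {rmorphism R -> L})
    (M : set L) (n : nat) (b : 'I_n -> L) : Prop :=
  (forall x, M x <-> exists a : 'I_n -> R, x = \sum_i f (a i) * b i) /\
  (forall a : 'I_n -> R, \sum_i f (a i) * b i = 0 -> forall i, a i = 0).

Definition ring_of_integers : set L := integral_closure int_embed.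

Definition is_integral_basis (n : nat) (b : 'I_n -> L) : Prop :=
  is_module_basis int_embed ring_of_integers b.

Definition is_p_integral_basis (p n : nat) (b : 'I_n -> L) : Prop :=
  is_module_basis (zlocal_embed p) (integral_closure (zlocal_embed p)) b.

Definition Zadjoin (xi : L) : set L :=
  [set x | exists q : {poly int}, x = (map_poly int_embed q).[xi]]%classic.

(* A / B has exactly m cosets, represented by r. *)
Definition has_index (A B : set L) (m : nat) : Prop :=
  exists r : 'I_m -> L,
    (forall i, A (r i)) /\ (forall x, A x -> exists! i, B (x - r i)).

(* Meant for additive subgroups B of A; the value is 0 if A / B is infinite. *)
Definition quotient_index (A B : set L) : nat := xget 0%N (has_index A B).

End NumberField.

Arguments int_embed L : clear implicits.
Arguments zlocal_embed L p : clear implicits.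
Arguments ring_of_integers L : clear implicits.

(* Main.v *)
Require Import Defs.
From mathcomp Require Import all_boot all_order all_algebra all_field.
From mathcomp Require Import boolp classical_sets.

Set Implicit Arguments.
Unset Strict Implicit.
Unset Printing Implicit Defensive.

Import Order.TTheory GRing.Theory Num.Theory.
Local Open Scope ring_scope.

(** Write A for the ring of integers and M for the Z-span of the alpha_i; both
    are subgroups of L, and the theorem says that they coincide and that the
    alpha_i are independent.

    Both inclusions come from one local-global principle
    ([subgroup_set_local_global]): if some positive multiple N x lies in a
    subgroup M, and for every prime q dividing N a multiple of x prime to q
    lies in M, then x lies in M.  The bridge between the local bases and the
    global one is the identity
      T alpha_i = alpha_{r i} + (an integer combination of xi^j with j < i),
    where T is the part of t_i prime to p_r: it holds because p_r^{k_{i,r}}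
    divides c_{ij} - c_{ij}^{(r)}.

    M <= A: t_i alpha_i lies in Z[xi], and the primes dividing t_i are among
    the p_r.  As alpha_{r i} is integral over Z_(p_r), clearing denominators in
    an equation of integral dependence makes a multiple of it prime to p_r
    integral over Z ([integral_Zlocal_denom]); by the identity the same holds
    for alpha_i.

    A <= M: the formula for alpha_i, solved for xi^i, shows by induction that
    every xi^i with i < n lies in M; hence M contains Z[xi]
    ([Zadjoin_sub_Zspan_powers]) and, by the identity, all alpha_{r i}.  For x
    in A the index multiplies x into Z[xi] ([has_index_mulrn]).  At the prime
    p_r, x has coordinates in Z_(p_r) in the local basis, and a common
    denominator of these is a multiplier prime to p_r that sends x into M.
    The index is not 0, the value standing for an infinite one, since 0 is
    divisible by every prime whereas the p_r are finitely many.

    Independence: M contains 1, xi, ..., xi^(n-1), so the n elements alpha_i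
    span the n-dimensional space L over Q. *)

(** * Subgroups and the local-global principle *)

Definition subgroup_set (V : zmodType) (M : set V) : Prop :=
  M 0 /\ forall x y, M x -> M y -> M (x - y).

Section SubgroupSet.
Variables (V : zmodType) (M : set V).
Hypothesis M_sub : subgroup_set M.

Lemma subgroup_setN x : M x -> M (- x).
Proof. by case: M_sub => M0 MB Mx; rewrite -sub0r; apply: MB. Qed.

Lemma subgroup_setD x y : M x -> M y -> M (x + y).
Proof.
case: (M_sub) => _ MB Mx My; rewrite -[y]opprK; apply: MB => //.
exact: subgroup_setN.
Qed.

Lemma subgroup_setMn x d : M x -> M (x *+ d).
Proof.
move=> Mx; elim: d => [|d IHd]; first by case: M_sub.
by rewrite mulrS; apply: subgroup_setD.
Qed.

Lemma subgroup_setMz x (z : int) : M x -> M (x *~ z).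
Proof.
by case: z => d Mx; [exact: subgroup_setMn|apply/subgroup_setN/subgroup_setMn].
Qed.

Lemma subgroup_set_sum (I : finType) (F : I -> V) :
  (forall i, M (F i)) -> M (\sum_i F i).
Proof.
move=> MF; elim/big_ind: _ => //; first by case: M_sub.
exact: subgroup_setD.
Qed.

(** The positive d with [x *+ d] in M are the multiples of the least one, which
    therefore divides N; a prime factor q of it would contradict the existence
    of such a d prime to q. *)
Lemma subgroup_set_local_global x N :
    (0 < N)%N -> M (x *+ N) ->
    (forall q, prime q -> (q %| N)%N -> exists2 d, coprime q d & M (x *+ d)) ->
  M x.
Proof.
move=> N_gt0 MxN loc.
have exd : exists d, (0 < d)%N && `[< M (x *+ d) >].
  by exists N; rewrite N_gt0; apply/asboolP.
case: (ex_minnP exd) => d /andP[d_gt0 /asboolP Mxd] d_min.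
have d_dvd e : M (x *+ e) -> (d %| e)%N.
  move=> Mxe; rewrite /dvdn; apply/eqP/eqP; rewrite -leqn0 leqNgt.
  apply/negP => r_gt0.
  have Mxr : M (x *+ (e %% d)).
    have -> : x *+ (e %% d) = x *+ e - x *+ d *+ (e %/ d).
      by rewrite [in x *+ e](divn_eq e d) mulrnDr mulnC mulrnA addrC addKr.
    by case: M_sub => _; apply => //; apply: subgroup_setMn.
  have := d_min (e %% d)%N; rewrite r_gt0 (introT (asboolP _) Mxr) => /(_ isT).
  by rewrite leqNgt ltn_pmod.
have [d_gt1|] := ltnP 1 d; last first.
  by case: d d_gt0 Mxd {d_min d_dvd} => [|[|]].
have [e q_e Mxe] :=
  loc _ (pdiv_prime d_gt1) (dvdn_trans (pdiv_dvd d) (d_dvd _ MxN)).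
have := dvdn_trans (pdiv_dvd d) (d_dvd _ Mxe).
have := pdiv_prime d_gt1; move: q_e; set q := pdiv d => q_e q_pr.
by rewrite -[e]mul1n Gauss_dvdl // dvdn1; case: eqP q_pr => // ->.
Qed.

End SubgroupSet.

(** * The index *)

Section NumberField.
Variable L : fieldExtType rat.

Lemma natL_neq0 d : (0 < d)%N -> d%:R != 0 :> L.
Proof.
move=> d_gt0; rewrite -(rmorph_nat (in_alg L)) fmorph_eq0 pnatr_eq0.
by rewrite -lt0n.
Qed.

Lemma ring_of_integers_subgroup : subgroup_set (ring_of_integers L).
Proof. by split; [apply: integral0 | move=> x y; apply: integral_sub]. Qed.

Lemma Zadjoin_subgroup (xi : L) : subgroup_set (Zadjoin xi).
Proof.
split; first by exists 0; rewrite rmorph0 horner0.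
by move=> _ _ [f ->] [g ->]; exists (f - g); rewrite rmorphB hornerD hornerN.
Qed.

Lemma has_index_quotient_index (A B : set L) :
  (0 < quotient_index A B)%N -> has_index A B (quotient_index A B).
Proof.
move=> m_gt0; apply: contrapT => not_index; move: m_gt0.
rewrite /quotient_index xgetPN // => m m_index.
by apply: not_index; apply: xgetI m_index.
Qed.

(** Translation by x permutes the cosets of B in A; summing
    [r i + x - r (sigma i)] over the representatives cancels these and leaves
    [x *+ m]. *)
Lemma has_index_mulrn (A B : set L) m x :
  subgroup_set A -> subgroup_set B -> has_index A B m -> A x -> B (x *+ m).
Proof.
move=> subA subB [r [Ar coset]] Ax.
have /choice[sigma sigmaP] : forall i, exists j, B (r i + x - r j).
  by move=> i; have [j []] := coset _ (subgroup_setD subA (Ar i) Ax); exists j.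
have sigma_inj : injective sigma.
  move=> i j eq_ij; have [l [_ l_uniq]] := coset _ (Ar i).
  rewrite -(l_uniq i); last by rewrite subrr; case: subB.
  apply/l_uniq.
  have -> : r i - r j = (r i + x - r (sigma i)) - (r j + x - r (sigma j)).
    by rewrite eq_ij opprB subrKA opprD addrACA subrr addr0.
  by case: subB => _; apply.
have := subgroup_set_sum subB sigmaP.
rewrite sumrB big_split /= sumr_const card_ord.
have <- : \sum_i r i = \sum_i r (sigma i) by rewrite (reindex_inj sigma_inj).
by rewrite addrAC subrr add0r.
Qed.

(** * Integral spans and Z[xi] *)

Definition Zspan n (b : 'I_n -> L) : set L :=
  [set x | exists a : 'I_n -> int, x = \sum_i int_embed L (a i) * b i]%classic.

Lemma Zspan_subgroup n (b : 'I_n -> L) : subgroup_set (Zspan b).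
Proof.
split.
  by exists (fun=> 0); rewrite big1 // => i _; rewrite rmorph0 mul0r.
move=> _ _ [a ->] [a' ->]; exists (fun i => a i - a' i).
by rewrite -sumrB; apply: eq_bigr => i _; rewrite rmorphB mulrBl.
Qed.

Lemma Zspan_gen n (b : 'I_n -> L) i : Zspan b (b i).
Proof.
exists (fun j => (j == i)%:R); rewrite (bigD1 i) //= eqxx mul1r big1 ?addr0 //.
by move=> j /negbTE->; rewrite mul0r.
Qed.

(** By Gauss's lemma, the minimal polynomial, dividing over Q a monic integer
    polynomial, is a rational multiple of an integer divisor g of it.  The
    leading coefficient of g divides 1, so it is a sign, and multiplying g by it
    gives the monic multiple. *)
Lemma monic_int_minPoly (xi : L) :
  ring_of_integers L xi ->
  exists2 P : {poly int}, P \is monic & map_poly (int_embed L) P = minPoly 1 xi.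
Proof.
move=> [f f_monic f_xi].
have /polyOver1P[m Dm] := minPolyOver 1%AS xi.
have map_intr (g : {poly int}) :
    map_poly (int_embed L) g = map_poly (in_alg L) (map_poly intr g).
  rewrite -map_poly_comp; apply: eq_map_poly => z.
  exact: (esym (rmorph_int (in_alg L) z)).
have m_monic : m \is monic by rewrite -(map_monic (in_alg L)) -Dm monic_minPoly.
have : m %| map_poly intr f.
  rewrite -(dvdp_map (in_alg L)) -Dm -map_intr.
  apply: minPoly_dvdp => //; rewrite map_intr; exact: alg_polyOver.
case/dvdpP_rat_int=> g [a a_neq0 Dmg] [h Df].
have lc2 : lead_coef g * lead_coef g = 1.
  have : lead_coef g \is a intUnitRing.unitz.
    apply: (@intUnitRing.unitzPl _ (lead_coef h)).
    by rewrite mulrC -lead_coefM -Df (monicP f_monic).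
  by rewrite unfold_in => /orP[] /eqP->.
exists (lead_coef g *: g); first by rewrite monicE lead_coefZ lc2.
rewrite map_intr Dm; congr map_poly; rewrite map_polyZ Dmg; congr (_ *: _).
have := monicP m_monic.
rewrite Dmg lead_coefZ lead_coef_map_inj //; last exact: intr_inj.
move/(congr1 (fun z => z * (lead_coef g)%:~R)).
by rewrite -mulrA -rmorphM lc2 mulr1 mul1r.
Qed.

(** Euclidean division by the minimal polynomial stays inside [{poly int}], as
    it is monic with integer coefficients. *)
Lemma Zadjoin_sub_Zspan_powers (xi x : L) :
  ring_of_integers L xi -> Zadjoin xi x ->
  Zspan (fun i : 'I_(adjoin_degree 1 xi) => xi ^+ i) x.
Proof.
move=> /monic_int_minPoly[P P_monic DP] [f ->].
have szP : size P = (adjoin_degree 1 xi).+1.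
  rewrite -(size_minPoly 1%AS) -DP size_map_poly_id0 //.
  by rewrite (monicP P_monic) rmorph1 oner_eq0.
exists (fun i => (Pdiv.Ring.rmodp f P)`_i).
rewrite {1}(Pdiv.RingMonic.rdivp_eq P_monic f) rmorphD rmorphM /=.
rewrite hornerD hornerM DP minPolyxx mulr0 add0r.
rewrite (@horner_coef_wide _ (adjoin_degree 1 xi)).
  by apply: eq_bigr => i _; rewrite coef_map.
rewrite (leq_trans (size_poly _ _)) // -ltnS -szP.
by rewrite Pdiv.Ring.ltn_rmodpN0 ?monic_neq0.
Qed.

(** * Clearing denominators prime to p *)

Lemma Zlocal_common_denom p n (a : 'I_n -> Zlocal p) :
  exists2 d, coprime p d &
    forall i, exists z : int, zlocal_embed L p (a i) *+ d = z%:~R.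
Proof.
exists (\prod_i `|denq (val (a i))|)%N.
  elim/big_ind: _ => [|x y px py|i _]; first exact: coprimen1.
    by rewrite coprimeMr px.
  exact: valP (a i).
move=> i; rewrite (bigD1 i) // mulrnA.
set e := (\prod_(j | _) _)%N.
exists (numq (val (a i)) *+ e); rewrite rmorphMn; congr (_ *+ _).
rewrite -[zlocal_embed L p (a i)]/(in_alg L (val (a i))) -rmorphMn.
have -> : val (a i) *+ `|denq (val (a i))|%N = (numq (val (a i)))%:~R.
  rewrite -mulr_natr -[X in _ * X]/(Posz `|denq (val (a i))|%N)%:~R.
  by rewrite absz_denq -numqE.
exact: rmorph_int.
Qed.

(** If P is monic of degree N and d is a common denominator of its coefficients,
    then d^N P(X / d) is monic, has integer coefficients and kills d x. *)
Lemma integral_Zlocal_denom p (x : L) :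
  integral_closure (zlocal_embed L p) x ->
  exists2 d, coprime p d & ring_of_integers L (x *+ d).
Proof.
move=> [P P_monic P_x].
have [d pd aE] := Zlocal_common_denom (fun i : 'I_(size P) => P`_i).
exists d => //.
pose N := (size P).-1.
have szP : size P = N.+1 by rewrite prednK // size_poly_gt0 monic_neq0.
pose Q := \poly_(i < N.+1) (zlocal_embed L p P`_i * d%:R ^+ (N - i)).
have PN : P`_N = 1 by exact: (monicP P_monic).
have QN : Q`_N = 1.
  by rewrite coef_poly ltnSn subnn mulr1 PN rmorph1.
have szQ : size Q = N.+1.
  apply/eqP; rewrite eqn_leq size_poly /=.
  rewrite ltnNge; apply/negP => /leq_sizeP/(_ N (leqnn N))/eqP.
  by rewrite QN oner_eq0.
apply: (@integral_root_monic _ _ _ _ Q).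
- by rewrite monicE /lead_coef szQ QN.
- apply/eqP; rewrite horner_poly.
  transitivity ((map_poly (zlocal_embed L p) P).[x] * d%:R ^+ N); last first.
    by rewrite (eqP P_x) mul0r.
  rewrite (@horner_coef_wide _ N.+1); last by rewrite -szP size_poly.
  rewrite mulr_suml; apply: eq_bigr => i _; rewrite coef_map.
  have le_iN : (i <= N)%N by rewrite -ltnS.
  by rewrite -[x *+ d]mulr_natr exprMn mulrACA -exprD subnK.
- apply/integral_poly => i; rewrite coef_poly.
  case: ifP => [|_]; last exact: integral0.
  rewrite ltnS leq_eqVlt => /orP[/eqP->|lt_iN].
    rewrite subnn mulr1 PN rmorph1; exact: integral1.
  rewrite -(subnSK lt_iN) exprS mulrA.
  have lt_iP : (i < size P)%N by rewrite szP ltnS ltnW.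
  have [z] := aE (Ordinal lt_iP); rewrite -mulr_natr /= => ->.
  apply: integral_mul; first exact: (integral_id (int_embed L) z).
  rewrite -natrX; exact: integral_nat.
Qed.

(** * The global basis *)

(** The b i span L over Q, as xi^0, ..., xi^(n-1) do, and n vectors spanning a
    space of dimension n are independent. *)
Lemma Zspan_free n (b : 'I_n -> L) (xi : L) :
    <<1; xi>>%VS = {:L}%VS -> \dim {:L} = n ->
    (forall j : 'I_n, Zspan b (xi ^+ j)) ->
  forall a : 'I_n -> int,
    \sum_i int_embed L (a i) * b i = 0 -> forall i, a i = 0.
Proof.
move=> L_gen L_deg b_xi.
have deg_xi : adjoin_degree 1 xi = n.
  by rewrite adjoin_degreeE L_gen L_deg dimv1 divn1.
pose X := [tuple b i | i < n].
have XE (i : 'I_n) : X`_i = b i by rewrite -tnth_nth tnth_mktuple.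
have span_X : ({:L} <= <<X>>)%VS.
  apply/subvP => x; rewrite -{1}L_gen => /Fadjoin_poly_eq <-.
  set f := Fadjoin_poly _ _ _.
  rewrite (@horner_coef_wide _ n); last by rewrite -deg_xi size_Fadjoin_poly.
  apply: rpred_sum => j _.
  have /polyOverP/(_ j)/vlineP[c ->] := Fadjoin_polyOver 1%AS xi x.
  rewrite -scalerAl mul1r; apply: rpredZ.
  have [a ->] := b_xi j; apply: rpred_sum => i _.
  rewrite /= mulrzl; apply: rpredMz; apply: memv_span.
  by rewrite -XE mem_nth // size_tuple.
have X_free : free X.
  have : basis_of {:L} X by rewrite basisEdim span_X size_tuple L_deg /=.
  exact: basis_free.
move=> a a0 i; apply/eqP; rewrite -(intr_eq0 rat); apply/eqP.
apply: (freeP X_free (fun i => (a i)%:~R)).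
rewrite -[RHS]a0; apply: eq_bigr => j _.
by rewrite XE /= mulrzl scaler_int.
Qed.

End NumberField.

Lemma coprime_prod_other_primes s (p k : 'I_s -> nat) r :
    injective p -> (forall r, prime (p r)) ->
  coprime (p r) (\prod_(r' | r' != r) p r' ^ k r').
Proof.
move=> p_inj p_pr.
elim/big_ind: _ => [|x y px py|r' r'r]; first exact: coprimen1.
  by rewrite coprimeMr px.
apply: coprimeXr; rewrite prime_coprime // dvdn_prime2 //.
by apply: contraNneq r'r => /p_inj->.
Qed.

Theorem theorem1p2 (L : fieldExtType rat) (n : nat) (xi : L)
  (L_gen : <<1; xi>>%VS = {:L}%VS)
  (L_deg : \dim {:L} = n)
  (xi_int : ring_of_integers L xi)
  (AL_neq : ring_of_integers L <> Zadjoin xi)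
  (s : nat) (p : 'I_s -> nat) (p_inj : injective p)
  (p_all : forall q : nat,
     (prime q /\ (q %| quotient_index (ring_of_integers L) (Zadjoin xi))%N)
     <-> exists r, q = p r)
  (k : 'I_s -> nat -> nat) (cr : 'I_s -> nat -> nat -> int)
  (alphar : 'I_s -> nat -> L)
  (k_mono : forall r i, (1 <= i)%N -> (i.+1 <= n.-1)%N -> (k r i <= k r i.+1)%N)
  (alphar0 : forall r, alphar r 0%N = 1)
  (alpharE : forall r i, (1 <= i <= n.-1)%N ->
     alphar r i = (\sum_(j < i) (cr r i j)%:~R * xi ^+ j + xi ^+ i)
                  / (p r ^ k r i)%:R)
  (alphar_basis : forall r, is_p_integral_basis (p r) (fun i : 'I_n => alphar r i))
  (c : nat -> nat -> int)
  (c_cong : forall r i j, (1 <= i <= n.-1)%N -> (j <= i.-1)%N ->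
     (c i j = cr r i j %[mod (p r ^ k r i)%N%:Z])%Z)
  (t : nat -> nat)
  (tE : forall i, (1 <= i <= n.-1)%N -> t i = (\prod_(r < s) p r ^ k r i)%N)
  (alpha : nat -> L)
  (alpha0 : alpha 0%N = 1)
  (alphaE : forall i, (1 <= i <= n.-1)%N ->
     alpha i = (\sum_(j < i) (c i j)%:~R * xi ^+ j + xi ^+ i) / (t i)%:R) :
  is_integral_basis (fun i : 'I_n => alpha i).
Proof.
have p_pr r : prime (p r).
  by case/p_all: (ex_intro _ r erefl : exists r', p r = p r').
set m := quotient_index _ _ in p_all.
(* If m were 0, a prime larger than all the p r would be one of them. *)
have m_gt0 : (0 < m)%N.
  rewrite lt0n; apply/negP => /eqP m0.
  have [q q_gt q_pr] := prime_above (\max_r p r).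
  have [r Dq] : exists r, q = p r by apply/p_all; rewrite m0 dvdn0.
  by move: q_gt; rewrite Dq ltnNge leq_bigmax.
have m_index : has_index (ring_of_integers L) (Zadjoin xi) m.
  exact: has_index_quotient_index.
have n_gt0 : (0 < n)%N by rewrite -L_deg adim_gt0.
have deg_xi : adjoin_degree 1 xi = n.
  by rewrite adjoin_degreeE L_gen L_deg dimv1 divn1.
have ordP i : (0 < i)%N -> (i < n)%N -> (1 <= i <= n.-1)%N.
  by move=> -> i_lt; rewrite -ltnS prednK.
have subA := ring_of_integers_subgroup L.
pose M := Zspan (fun i : 'I_n => alpha i).
have subM : subgroup_set M by apply: Zspan_subgroup.
have M_alpha i : (i < n)%N -> M (alpha i).
  by move=> lt_in; apply: (Zspan_gen (fun i : 'I_n => alpha i) (Ordinal lt_in)).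
have t_gt0 i : (0 < i)%N -> (i < n)%N -> (0 < t i)%N.
  move=> i_gt0 lt_in; rewrite tE ?ordP // prodn_gt0 // => r.
  by rewrite expn_gt0 prime_gt0.
pose T r i := (\prod_(r' | r' != r) p r' ^ k r' i)%N.
(* z j is (c i j - cr r i j) / p_r^(k r i), an integer by the congruences;
   multiplying by T r i turns the denominator t i into p_r^(k r i). *)
have compare r i : (0 < i)%N -> (i < n)%N -> exists z : 'I_i -> int,
    alpha i *+ T r i = alphar r i + \sum_(j < i) (xi ^+ j) *~ z j.
  move=> i_gt0 lt_in; have i_rng := ordP _ i_gt0 lt_in.
  have /choice[z zP] : forall j : 'I_i, exists z : int,
      c i j = cr r i j + z * (p r ^ k r i)%N.
    move=> j; have := c_cong r i j i_rng.
    rewrite -ltnS prednK // ltn_ord => /(_ isT)/eqP.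
    rewrite eqz_mod_dvd => /dvdzP[z Dz]; exists z.
    by rewrite -Dz addrC subrK.
  exists z; have pk_neq0 : (p r ^ k r i)%:R != 0 :> L.
    by apply: natL_neq0; rewrite expn_gt0 prime_gt0.
  have T_neq0 : (T r i)%:R != 0 :> L.
    by apply: natL_neq0; rewrite prodn_gt0 // => r'; rewrite expn_gt0 prime_gt0.
  have Dt : t i = (p r ^ k r i * T r i)%N by rewrite tE // (bigD1 r).
  rewrite -mulr_natr alphaE // alpharE // Dt natrM invfM.
  rewrite -!mulrA mulVf // mulr1.
  apply: (mulIf pk_neq0); rewrite [RHS]mulrDl !mulfVK //.
  rewrite addrAC; congr (_ + _); rewrite mulr_suml -big_split /=.
  apply: eq_bigr => j _; rewrite zP rmorphD rmorphM mulrDl /=; congr (_ + _).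
  by rewrite -[in RHS]mulrzl -!mulrA; congr (_ * _); rewrite mulrC.
have M_pow i : (i < n)%N -> M (xi ^+ i).
  elim/ltn_ind: i => i IHi lt_in; have [i0|i_gt0] := posnP i.
    by rewrite i0 expr0 -alpha0; apply: M_alpha.
  have i_rng := ordP _ i_gt0 lt_in.
  have -> : xi ^+ i = alpha i *+ t i - \sum_(j < i) (xi ^+ j) *~ c i j.
    rewrite -mulr_natr alphaE // mulfVK ?natL_neq0 ?t_gt0 //.
    under [X in _ - X]eq_bigr do rewrite -mulrzl.
    by rewrite addrC addKr.
  case: (subM) => _; apply; first exact/(subgroup_setMn subM)/M_alpha.
  apply: (subgroup_set_sum subM) => j; apply: (subgroup_setMz subM).
  by apply: IHi => //; apply: ltn_trans lt_in.
have M_alphar r i : (i < n)%N -> M (alphar r i).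
  move=> lt_in; have [->|i_gt0] := posnP i.
    by rewrite alphar0 -alpha0; apply: M_alpha.
  have [z Dz] := compare r i i_gt0 lt_in.
  rewrite -[alphar r i](addrK (\sum_(j < i) (xi ^+ j) *~ z j)) -Dz.
  case: (subM) => _; apply; first exact/(subgroup_setMn subM)/M_alpha.
  apply: (subgroup_set_sum subM) => j; apply: (subgroup_setMz subM).
  by apply: M_pow; apply: ltn_trans lt_in.
have A_xi j : ring_of_integers L (xi ^+ j).
  elim: j => [|j IHj]; first exact: integral1.
  by rewrite exprS; apply: integral_mul.
have A_alpha i : (i < n)%N -> ring_of_integers L (alpha i).
  move=> lt_in; have [->|i_gt0] := posnP i.
    by rewrite alpha0; apply: integral1.
  have i_rng := ordP _ i_gt0 lt_in.
  apply: (subgroup_set_local_global subA (t_gt0 _ i_gt0 lt_in)).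
    rewrite -mulr_natr alphaE // mulfVK ?natL_neq0 ?t_gt0 //.
    apply: (subgroup_setD subA) => //.
    apply: (subgroup_set_sum subA) => j; rewrite mulrzl.
    exact: subgroup_setMz.
  move=> q q_pr; rewrite tE // Euclid_dvd_prod // big_orE => /existsP[r].
  rewrite /= Euclid_dvdX // dvdn_prime2 // => /andP[/eqP-> _].
  have := (alphar_basis r).1 (alphar r i) => -[_ alphar_int].
  have /integral_Zlocal_denom[d pd Ad] :
      integral_closure (zlocal_embed L (p r)) (alphar r i).
    apply: alphar_int; exists (fun j => (nat_of_ord j == i)%:R).
    rewrite (bigD1 (Ordinal lt_in)) // eqxx rmorph1 mul1r big1 => [|j].
      exact: (esym (addr0 _)).
    by rewrite -(inj_eq val_inj) => /= /negbTE->; rewrite scale0r mul0r.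
  exists (T r i * d)%N; first by rewrite coprimeMr pd coprime_prod_other_primes.
  have [z Dz] := compare r i i_gt0 lt_in.
  rewrite mulrnA Dz mulrnDl; apply: (subgroup_setD subA) => //.
  apply: (subgroup_setMn subA).
  by apply: (subgroup_set_sum subA) => j; apply: (subgroup_setMz subA).
split; last first.
  exact: Zspan_free L_gen L_deg (fun j => M_pow _ (ltn_ord j)).
move=> x; split=> [Ax|[a ->]]; last first.
  apply: (subgroup_set_sum subA) => i; rewrite /= mulrzl.
  exact/(subgroup_setMz subA)/A_alpha.
apply: (subgroup_set_local_global subM m_gt0).
  have := has_index_mulrn subA (Zadjoin_subgroup xi) m_index Ax.
  move/(Zadjoin_sub_Zspan_powers xi_int) => [a ->].
  apply: (subgroup_set_sum subM) => j; rewrite /= mulrzl.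
  apply: (subgroup_setMz subM).
  by apply: M_pow; rewrite -deg_xi.
move=> q q_pr q_m; have [r ->] : exists r, q = p r by apply/p_all.
have [a Dx] : exists a : 'I_n -> Zlocal (p r),
    x = \sum_i zlocal_embed L (p r) (a i) * alphar r i.
  apply/(alphar_basis r).1; case: Ax => f f_monic f_x.
  (* An equation over Z is one over Z_(p r). *)
  exists (map_poly intr f); first by rewrite monic_map.
  rewrite -map_poly_comp (eq_map_poly (g := int_embed L)) // => z.
  exact: (rmorph_int (zlocal_embed L (p r)) z).
have [d pd aE] := Zlocal_common_denom L a.
exists d => //; rewrite Dx -sumrMnl; apply: (subgroup_set_sum subM) => i.
have [z Dz] := aE i; rewrite -mulrnAl Dz mulrzl.
exact/(subgroup_setMz subM)/M_alphar.
Qed.
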